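(* Let $n,d\geq 1$ be integers, let $A_1,\ldots,A_n\in\mathcal{S}^d_+$ be real symmetric positive semidefinite $d\times d$ matrices, and let $M=(\operatorname{tr}(A_iA_j))_{i,j=1}^n\in\mathcal{CPSD}^n$. Set $\ell := \max_{i}\operatorname{tr}(A_i)$ and $L := \max_i M_{ii}$. Then for every real $\varepsilon$ with $0<\varepsilon<\frac12\min\{\ell^2,L\}$ there exists some $N\in\mathcal{CPSD}^n$ with $$\operatorname{cpsd-rank}(N)\leq \min\left\{ n\left\lceil \frac{9L\ell^2}{2\varepsilon^2}\right\rceil,\ \frac{(6\ell)^4\log\left(n\left\lceil \frac{18L\ell^2}{\varepsilon^2}\right\rceil+1\right)}{\varepsilon^2}\right\}$$ and $$|M_{ij}-N_{ij}|<\varepsilon\quad\text{for all } i,j\in\{1,\ldots,n\}.$$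
   Context: $\mathcal{S}^d_+$ denotes the set of real symmetric positive semidefinite $d\times d$ matrices. A real symmetric $n\times n$ matrix $A$ is completely positive semidefinite (cpsd) if there exist an integer $d\geq 1$ and $A_1,\ldots,A_n\in\mathcal{S}^d_+$ with $A_{ij}=\operatorname{tr}(A_iA_j)$ for all $i,j$; such matrices $A_1,\ldots,A_n$ are called a Gram representation of $A$. $\mathcal{CPSD}^n$ denotes the set of all $n\times n$ cpsd matrices. For $A\in\mathcal{CPSD}^n$, $\operatorname{cpsd-rank}(A)$ is the smallest $d\geq 1$ for which there is a Gram representation of $A$ by matrices $A_1,\ldots,A_n\in\mathcal{S}^d_+$. $\log$ is the natural logarithm. *)

(* Defs.v *)
From HB Require Import structures.
From mathcomp Require Import all_boot all_order all_algebra.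
From mathcomp Require Import all_classical all_reals all_analysis.

Set Implicit Arguments.
Unset Strict Implicit.
Unset Printing Implicit Defensive.

Import Order.TTheory GRing.Theory Num.Theory.
Local Open Scope ring_scope.

Definition psdmx (R : realType) (d : nat) (A : 'M[R]_d) : Prop :=
  A \is symmetricmx /\ forall v : 'cV[R]_d, 0 <= (v^T *m A *m v) 0 0.

Definition gram_mx (R : realType) (n d : nat) (A : 'I_n -> 'M[R]_d) : 'M[R]_n :=
  \matrix_(i, j) \tr (A i *m A j).

Definition gram_rep (R : realType) (n d : nat) (M : 'M[R]_n)
    (A : 'I_n -> 'M[R]_d) : Prop :=
  (forall i, psdmx (A i)) /\ M = gram_mx A.

Definition has_gram_rep (R : realType) (n : nat) (M : 'M[R]_n) (d : nat) : Prop :=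
  (1 <= d)%N /\ exists A : 'I_n -> 'M[R]_d, gram_rep M A.

(* Symmetry of M is not required separately: \tr (A *m B) = \tr (B *m A). *)
Definition cpsd (R : realType) (n : nat) (M : 'M[R]_n) : Prop :=
  exists d : nat, has_gram_rep M d.

Lemma cpsd_asbool (R : realType) (n : nat) (M : 'M[R]_n) :
  cpsd M -> exists d : nat, `[< has_gram_rep M d >].
Proof. by case=> d Md; exists d; apply/asboolP. Qed.

(* The rank takes a proof of cpsd M, so no value is assigned outside CPSD^n. *)
Definition cpsd_rank (R : realType) (n : nat) (M : 'M[R]_n) (hM : cpsd M) : nat :=
  ex_minn (cpsd_asbool hM).

(* The hypothesis 0 < n provides the first index, whose value seeds the
   iterated maximum, so this is the true maximum for f of any sign. *)
Definition max_ord (R : realType) (n : nat) (hn : (0 < n)%N) (f : 'I_n -> R) : R :=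
  \big[Num.max/f (Ordinal hn)]_(i < n) f i.

(* Main.v *)
(* Each [A i] is reduced by repeated Schur complements, taken as long as some
   direction has Rayleigh quotient above [ell / k]; every step costs more than
   [ell / k] of trace, so at most [k] rank-one terms are split off, and the
   remainder [B] satisfies [\tr (B *m B) <= ell ^+ 2 / k]. The truncated Gram
   matrix only involves the inner products of [n * k] vectors. Realizing these
   vectors in dimension [n * k] gives the first bound. Projecting them by a
   random sign matrix (Johnson-Lindenstrauss), which changes each inner product
   [<u, v>] by at most [|u| |v|] times a factor of order [eps / ell ^+ 2], gives
   the second. *)

Require Import Defs.
From HB Require Import structures.
From mathcomp Require Import all_boot all_order all_algebra.
From mathcomp Require Import all_classical all_reals all_analysis.
From mathcomp Require Import ring lra.

Set Implicit Arguments.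
Unset Strict Implicit.
Unset Printing Implicit Defensive.

Import Order.TTheory GRing.Theory Num.Theory.
Local Open Scope ring_scope.

(** * Psd matrices: Cauchy-Schwarz inequalities, Schur complements, truncation to few rank-one
    terms *)

Section PsdMatrices.
Variable R : realType.

Definition dot d (u v : 'cV[R]_d) : R := (u^T *m v) 0 0.

Lemma dotE d (u v : 'cV[R]_d) : dot u v = \sum_i u i 0 * v i 0.
Proof. by rewrite /dot mxE; apply: eq_bigr => i _; rewrite mxE. Qed.

Lemma dotC d (u v : 'cV[R]_d) : dot u v = dot v u.
Proof. by rewrite !dotE; apply: eq_bigr => i _; rewrite mulrC. Qed.

Lemma dotDr d (u v w : 'cV[R]_d) : dot u (v + w) = dot u v + dot u w.
Proof. by rewrite /dot mulmxDr mxE. Qed.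

Lemma dotZr d a (u v : 'cV[R]_d) : dot u (a *: v) = a * dot u v.
Proof. by rewrite /dot -scalemxAr mxE. Qed.

Lemma dotNr d (u v : 'cV[R]_d) : dot u (- v) = - dot u v.
Proof. by rewrite -scaleN1r dotZr mulN1r. Qed.

Lemma dotDl d (u v w : 'cV[R]_d) : dot (v + w) u = dot v u + dot w u.
Proof. by rewrite !(dotC _ u) dotDr. Qed.

Lemma dotZl d a (u v : 'cV[R]_d) : dot (a *: u) v = a * dot u v.
Proof. by rewrite !(dotC _ v) dotZr. Qed.

Lemma dot0l d (u : 'cV[R]_d) : dot 0 u = 0.
Proof. by rewrite -(scale0r 0) dotZl mul0r. Qed.

Lemma dot_col_mx m n (a b : 'cV[R]_m) (u v : 'cV[R]_n) :
  dot (col_mx a u) (col_mx b v) = dot a b + dot u v.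
Proof. by rewrite /dot tr_col_mx mul_row_col mxE. Qed.

Lemma dot_ge0 d (u : 'cV[R]_d) : 0 <= dot u u.
Proof. by rewrite dotE; apply: sumr_ge0 => i _; rewrite -expr2 sqr_ge0. Qed.

Lemma dot_eq0 d (u : 'cV[R]_d) : dot u u = 0 -> u = 0.
Proof.
rewrite dotE => /psumr_eq0P u0; apply/colP => i; rewrite mxE; apply/eqP.
by rewrite -sqrf_eq0 expr2 u0 // => j _; rewrite -expr2 sqr_ge0.
Qed.

(** Common source of the Cauchy-Schwarz inequalities for psd forms and for the trace form. *)
Lemma discriminant_le (a b c : R) :
  (forall x y, 0 <= a * x ^+ 2 + 2 * b * x * y + c * y ^+ 2) ->
  b ^+ 2 <= a * c.
Proof.
move=> h; have c0 : 0 <= c.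
  by have := h 0 1; rewrite !expr2 !mulr0 !mul0r !mulr1 !add0r.
have [c0'|cN0] := eqVneq c 0; last first.
  have cp : 0 < c by rewrite lt_neqAle eq_sym cN0.
  (* At [(c, - b)] the form equals [c * (a * c - b ^+ 2)]. *)
  have := h c (- b); rewrite -subr_ge0 => {}h.
  rewrite -subr_ge0 -(pmulr_rge0 _ cp); move: h; congr (0 <= _); ring.
rewrite c0' mulr0; have [->|bN0] := eqVneq b 0; first by rewrite expr0n.
(* With [c = 0] and [x = 1] the form is affine in [y]; this [y] gives it the value [-1]. *)
have := h 1 (- (a + 1) / (2 * b)).
rewrite c0' mul0r addr0 expr1n mulr1.
have -> : a + 2 * b * 1 * (- (a + 1) / (2 * b)) = -1.
  by field; rewrite bN0.
lra.
Qed.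

Lemma psdmx_tr d (A : 'M[R]_d) : psdmx A -> A^T = A.
Proof.
by case=> /is_hermitianmxP AE _; rewrite [RHS]AE expr0 scale1r map_mx_id.
Qed.

Lemma psdmx_dot d (A : 'M[R]_d) v : psdmx A -> 0 <= dot v (A *m v).
Proof. by case=> _ /(_ v); rewrite /dot mulmxA. Qed.

Lemma psdmxI d (A : 'M[R]_d) :
  A^T = A -> (forall v, 0 <= dot v (A *m v)) -> psdmx A.
Proof.
move=> sA pA; split=> [|v]; last by rewrite -mulmxA; exact: pA.
by apply/is_hermitianmxP; rewrite expr0 scale1r map_mx_id.
Qed.

Lemma dot_mulmx_tr m d (A : 'M[R]_(m, d)) u v :
  dot (A *m u) v = dot u (A^T *m v).
Proof. by rewrite /dot trmx_mul mulmxA. Qed.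

Lemma psdmx_sym d (A : 'M[R]_d) u v : psdmx A -> dot (A *m u) v = dot u (A *m v).
Proof. by move=> /psdmx_tr sA; rewrite dot_mulmx_tr sA. Qed.

Lemma psdmx_CS d (A : 'M[R]_d) u v : psdmx A ->
  dot u (A *m v) ^+ 2 <= dot u (A *m u) * dot v (A *m v).
Proof.
move=> pA; apply: discriminant_le => x y.
have := psdmx_dot (x *: u + y *: v) pA; congr (0 <= _).
rewrite mulmxDr -!scalemxAr !(dotDl, dotDr, dotZl, dotZr).
rewrite -[dot v (A *m u)]psdmx_sym // [dot (A *m v) u]dotC; ring.
Qed.

Lemma psdmx1 d : psdmx (1%:M : 'M[R]_d).
Proof. by apply: psdmxI => [|v]; rewrite ?trmx1 // mul1mx dot_ge0. Qed.

Lemma dot_CS d (u v : 'cV[R]_d) : dot u v ^+ 2 <= dot u u * dot v v.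
Proof. by have := psdmx_CS u v (psdmx1 d); rewrite !mul1mx. Qed.

(** Cauchy-Schwarz for the form of [A], taken at [A *m v] and [v], bounds [|A v|^4] by zero. *)
Lemma psdmx_eq0 d (A : 'M[R]_d) v :
  psdmx A -> dot v (A *m v) = 0 -> A *m v = 0.
Proof.
move=> pA v0; apply: dot_eq0; apply/eqP; rewrite -sqrf_eq0 eq_le sqr_ge0 andbT.
by have := psdmx_CS (A *m v) v pA; rewrite v0 mulr0.
Qed.

Lemma rank1_mul d (p u : 'cV[R]_d) : p *m p^T *m u = dot p u *: p.
Proof.
by rewrite -mulmxA [p^T *m u]mx11_scalar mul_mx_scalar.
Qed.

Lemma tr_rank1 d (p q : 'cV[R]_d) : \tr (p *m q^T) = dot p q.
Proof. by rewrite mxtrace_mulC /mxtrace big_ord1 dotC. Qed.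

Lemma tr_dot_delta d (A : 'M[R]_d) :
  \tr A = \sum_i dot (delta_mx i 0) (A *m delta_mx i 0).
Proof.
apply: eq_bigr => i _; rewrite dotE (bigD1 i) //= big1 => [|j ji].
  by rewrite -colE !mxE !eqxx mul1r addr0.
by rewrite mxE (negPf ji) mul0r.
Qed.

Lemma psdmx_tr_ge0 d (A : 'M[R]_d) : psdmx A -> 0 <= \tr A.
Proof.
by move=> pA; rewrite tr_dot_delta; apply: sumr_ge0 => i _; apply: psdmx_dot.
Qed.

(* When [dot v (A *m v) = 0] the inverse is [0] and [A *m v = 0], so the
   properties below hold without a side condition. *)
Definition schur d (A : 'M[R]_d) (v : 'cV[R]_d) : 'M[R]_d :=
  A - (dot v (A *m v))^-1 *: (A *m v *m (A *m v)^T).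

Lemma schur_mul d (A : 'M[R]_d) v u :
  schur A v *m u = A *m u - ((dot v (A *m v))^-1 * dot (A *m v) u) *: (A *m v).
Proof. by rewrite mulmxBl -scalemxAl rank1_mul scalerA. Qed.

(** The form of the complement at [u] is [<u, A u> - <u, A v>^2 / <v, A v>], which Cauchy-Schwarz
    for [A] keeps nonnegative. *)
Lemma schur_psd d (A : 'M[R]_d) v : psdmx A -> psdmx (schur A v).
Proof.
move=> pA; apply: psdmxI => [|u].
  by rewrite linearB linearZ /= trmx_mul trmxK psdmx_tr.
rewrite schur_mul dotDr dotNr dotZr [dot (A *m v) u]dotC.
have := psdmx_CS u v pA; have := psdmx_dot v pA.
set c := dot v _ => c0 h; have [c0'|cN0] := eqVneq c 0.
  by rewrite c0' invr0 !mul0r subr0 psdmx_dot.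
have cp : 0 < c by rewrite lt_neqAle eq_sym cN0.
by rewrite -mulrA -expr2 subr_ge0 mulrC ler_pdivrMr.
Qed.

Lemma schur_kill d (A : 'M[R]_d) v : psdmx A -> schur A v *m v = 0.
Proof.
move=> pA; rewrite schur_mul [dot (A *m v) v]dotC.
have [v0|vN0] := eqVneq (dot v (A *m v)) 0.
  by rewrite (psdmx_eq0 pA v0) scaler0 subr0.
by rewrite mulVf // scale1r subrr.
Qed.

(** Directions killed by one complement stay killed by the later ones, which makes the Cholesky
    induction work. *)
Lemma schur_ker d (A : 'M[R]_d) (v u : 'cV[R]_d) :
  psdmx A -> A *m u = 0 -> schur A v *m u = 0.
Proof.
move=> pA Au0; rewrite schur_mul psdmx_sym // Au0.
by rewrite [dot v 0]dotC dot0l mulr0 scale0r subr0.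
Qed.

Lemma schur_add d (A : 'M[R]_d) v : psdmx A ->
  exists p : 'cV[R]_d, A = p *m p^T + schur A v.
Proof.
move=> pA; exists ((Num.sqrt (dot v (A *m v)))^-1 *: (A *m v)).
have := psdmx_dot v pA; rewrite /schur; set c := dot v _; set w := A *m v => c0.
rewrite [(_ *: w)^T]linearZ /= -[_ *: w *m _]scalemxAl -[w *m _]scalemxAr.
by rewrite scalerA -expr2 exprVn sqr_sqrtr // addrC subrK.
Qed.

(** With [c = <v, A v>] the trace drops by [|A v|^2 / c], and [c^2 <= |v|^2 |A v|^2] makes this at
    least [c / |v|^2 > th]. *)
Lemma schur_tr_lt d (A : 'M[R]_d) v th : psdmx A -> 0 < th ->
  th * dot v v < dot v (A *m v) -> \tr (schur A v) < \tr A - th.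
Proof.
move=> pA th0; set c := dot v (A *m v) => hv.
have v0 : 0 < dot v v.
  rewrite lt_neqAle dot_ge0 andbT eq_sym; apply/eqP => /dot_eq0 v0.
  by move: hv; rewrite /c v0 !dot0l mulr0 ltxx.
have c0 : 0 < c by rewrite (le_lt_trans _ hv) // mulr_ge0 ?dot_ge0 ?ltW.
rewrite /schur linearB /= mxtraceZ tr_rank1 ltrD2l ltrN2 -/c mulrC.
rewrite ltr_pdivlMr // -(ltr_pM2r v0).
apply: (@lt_le_trans _ _ (c ^+ 2)); first by rewrite expr2 mulrAC ltr_pM2r.
by rewrite [leRHS]mulrC; apply: dot_CS.
Qed.

Definition fcons T k (x : T) (f : 'I_k -> T) (i : 'I_k.+1) : T :=
  oapp f x (unlift ord0 i).

Lemma fcons0 T k (x : T) (f : 'I_k -> T) : fcons x f ord0 = x.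
Proof. by rewrite /fcons unlift_none. Qed.

Lemma fconsS T k (x : T) (f : 'I_k -> T) i : fcons x f (lift ord0 i) = f i.
Proof. by rewrite /fcons liftK. Qed.

Lemma sum_fcons T k (V : nmodType) (F : T -> V) (x : T) (f : 'I_k -> T) :
  \sum_i F (fcons x f i) = F x + \sum_i F (f i).
Proof.
by rewrite big_ord_recl fcons0; congr +%R; apply: eq_bigr => i _; rewrite fconsS.
Qed.

(* Peel off a Schur complement as long as some direction [v] violates the
   bound; each step lowers the trace by more than [th]. *)
Lemma psdmx_greedy d k (th : R) (A : 'M[R]_d) :
  0 < th -> psdmx A -> \tr A <= k%:R * th ->
  exists (p : 'I_k -> 'cV[R]_d) (B : 'M[R]_d),
    [/\ psdmx B, A = \sum_a p a *m (p a)^T + B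
      & forall v, dot v (B *m v) <= th * dot v v].
Proof.
move=> th0; elim: k A => [|k IH] A pA trA.
all: have [bnd|/existsNP[v /negP]] :=
  pselect (forall v, dot v (A *m v) <= th * dot v v).
- by exists (fun=> 0), A; rewrite big_ord0 add0r.
(* With no steps left the trace is at most [0], so one more complement would be psd with negative
   trace. *)
- rewrite -ltNge => /(schur_tr_lt pA th0).
  have := psdmx_tr_ge0 (schur_psd v pA); move: trA; rewrite mul0r; lra.
(* The bound already holds, so the family is padded with zero vectors. *)
- exists (fun=> 0), A; split=> //.
  by rewrite big1 ?add0r // => a _; rewrite mul0mx.
rewrite -ltNge => /(schur_tr_lt pA th0) hv.
have [|p [B [pB AE bB]]] := IH _ (schur_psd v pA).
  by move: trA; rewrite -natr1 mulrDl mul1r; lra.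
have [q qE] := schur_add v pA.
exists (fcons q p), B; split=> //.
by rewrite (sum_fcons (fun x => x *m x^T)) -addrA -AE.
Qed.

Lemma tr_rank1_mul d (p : 'cV[R]_d) (B : 'M[R]_d) :
  \tr (p *m p^T *m B) = dot p (B *m p).
Proof.
by rewrite -mulmxA mxtrace_mulC -mulmxA trace_mx11.
Qed.

Lemma tr_sqr_ge0 d (A : 'M[R]_d) : A^T = A -> 0 <= \tr (A *m A).
Proof.
move=> sA; apply: sumr_ge0 => i _; rewrite mxE; apply: sumr_ge0 => j _.
by rewrite -{2}sA mxE -expr2 sqr_ge0.
Qed.

Lemma tr_CS d (A B : 'M[R]_d) : A^T = A -> B^T = B ->
  \tr (A *m B) ^+ 2 <= \tr (A *m A) * \tr (B *m B).
Proof.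
move=> sA sB; apply: discriminant_le => x y.
have := @tr_sqr_ge0 _ (x *: A + y *: B).
rewrite linearD !linearZ /= sA sB => /(_ erefl); congr (0 <= _).
rewrite !(mulmxDl, mulmxDr) -!scalemxAl -!scalemxAr !mxtraceD !mxtraceZ.
rewrite [\tr (B *m A)]mxtrace_mulC; ring.
Qed.

(** No eigenvalues are needed: with [b = |B e|^2] for a basis vector [e], Cauchy-Schwarz for [B]
    gives [b^2 <= <B e, B (B e)> <e, B e> <= th * b * <e, B e>]. Divide by [b] and sum over [e]. *)
Lemma psdmx_tr_sqr_le d th (B : 'M[R]_d) : psdmx B ->
  (forall v, dot v (B *m v) <= th * dot v v) -> \tr (B *m B) <= th * \tr B.
Proof.
move=> pB bB; rewrite !tr_dot_delta mulr_sumr; apply: ler_sum => i _.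
set e := delta_mx i 0; rewrite -mulmxA -psdmx_sym //.
set b := dot _ _; have [b0|bN0] := eqVneq b 0.
  rewrite b0; have := bB e; have := psdmx_dot e pB.
  have -> : B *m e = 0 by apply: dot_eq0.
  by rewrite dotC dot0l mulr0.
have bp : 0 < b by rewrite lt_neqAle eq_sym bN0 dot_ge0.
rewrite -(ler_pM2r bp).
have := psdmx_CS (B *m e) e pB; rewrite -/b expr2 => /le_trans; apply.
rewrite mulrAC ler_wpM2r ?psdmx_dot //; exact: bB.
Qed.

Lemma psdmx_sum_rank1 d k (p : 'I_k -> 'cV[R]_d) :
  psdmx (\sum_a p a *m (p a)^T).
Proof.
apply: psdmxI => [|v].
  by rewrite linear_sum; apply: eq_bigr => a _; rewrite /= trmx_mul trmxK.
rewrite mulmx_suml /dot mulmx_sumr summxE; apply: sumr_ge0 => a _.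
by rewrite rank1_mul -/(dot _ _) dotZr [dot v _]dotC -expr2 sqr_ge0.
Qed.

(** Greedy splitting at threshold [ell / k]. The last clause lets a bound on [\tr (A *m A)] serve
    the truncation as well. *)
Lemma psdmx_truncate d k (ell : R) (A : 'M[R]_d) :
  (0 < k)%N -> 0 < ell -> psdmx A -> \tr A <= ell ->
  exists (p : 'I_k -> 'cV[R]_d) (B : 'M[R]_d),
    [/\ psdmx B, A = \sum_a p a *m (p a)^T + B,
        \sum_a dot (p a) (p a) <= ell,
        \tr (B *m B) <= ell ^+ 2 / k%:R
      & \tr ((\sum_a p a *m (p a)^T) *m (\sum_a p a *m (p a)^T))
          <= \tr (A *m A)].
Proof.
move=> k0 l0 pA trA; have k0' : 0 < k%:R :> R by rewrite ltr0n.
have th0 : 0 < ell / k%:R by rewrite divr_gt0.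
have [|p [B [pB AE bB]]] := @psdmx_greedy _ k _ _ th0 pA.
  by rewrite mulrC divfK // gt_eqF.
have trB := psdmx_tr_ge0 pB.
have trp : \tr (\sum_a p a *m (p a)^T) = \sum_a dot (p a) (p a).
  by rewrite linear_sum; apply: eq_bigr => a _; exact: tr_rank1.
have p0 : 0 <= \sum_a dot (p a) (p a) by apply: sumr_ge0 => a _; apply: dot_ge0.
have trE : \tr A = \sum_a dot (p a) (p a) + \tr B by rewrite AE mxtraceD trp.
exists p, B; split=> //.
- by lra.
- apply: le_trans (psdmx_tr_sqr_le pB bB) _.
  by rewrite expr2 [leRHS]mulrAC ler_wpM2l ?(ltW th0) //; lra.
(* Expanding [\tr (A *m A)] leaves this cross term, twice, and [\tr (B *m B)]; both are
   nonnegative. *)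
have pB0 : 0 <= \tr ((\sum_a p a *m (p a)^T) *m B).
  rewrite mulmx_suml linear_sum; apply: sumr_ge0 => a _.
  by rewrite /= tr_rank1_mul psdmx_dot.
have BB0 := tr_sqr_ge0 (psdmx_tr pB).
rewrite AE !(mulmxDl, mulmxDr) !mxtraceD [\tr (B *m _)]mxtrace_mulC; lra.
Qed.

End PsdMatrices.

(** * Cholesky factorization and Gram matrices of sums of rank-one terms *)

Section GramFamilies.
Variable R : realType.

(** One complement per vector [v a]. The kernel clause carries the vanishing on [v ord0] through the
    induction. *)
Lemma psdmx_cholesky_partial d k (v : 'I_k -> 'cV[R]_d) (A : 'M[R]_d) :
  psdmx A ->
  exists (p : 'I_k -> 'cV[R]_d) (B : 'M[R]_d),
    [/\ A = \sum_a p a *m (p a)^T + B, forall a, B *m v a = 0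
      & forall u : 'cV[R]_d, A *m u = 0 -> B *m u = 0].
Proof.
elim: k v A => [|k IH] v A pA.
  by exists (fun=> 0), A; split=> // [|[]//]; rewrite big_ord0 add0r.
have [p [B [AE Bv BA]]] := IH (v \o lift ord0) _ (schur_psd (v ord0) pA).
have [q qE] := schur_add (v ord0) pA.
exists (fcons q p), B; split.
- by rewrite (sum_fcons (fun x => x *m x^T)) -addrA -AE.
- move=> a; have [b ->|->] := unliftP ord0 a; [exact: Bv | exact/BA/schur_kill].
- by move=> u Au; apply/BA/schur_ker.
Qed.

(** For the standard basis the remainder kills every basis vector, so it is zero. *)
Lemma psdmx_cholesky d (A : 'M[R]_d) : psdmx A ->
  exists p : 'I_d -> 'cV[R]_d, A = \sum_a p a *m (p a)^T.
Proof.
move=> pA; have [p [B [AE Bv _]]] :=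
  psdmx_cholesky_partial (fun a => delta_mx a 0) pA.
exists p; rewrite AE [B](_ : _ = 0) ?addr0 //.
by apply/matrixP => i j; have /colP/(_ i) := Bv j; rewrite -colE !mxE.
Qed.

(** Makes the dimension depend only on the number of vectors: the Gram matrix [Q^T *m Q] has size
    [#|I|], and the rows of its Cholesky factor are the new vectors. *)
Lemma same_gram (I : finType) d (q : I -> 'cV[R]_d) :
  exists q' : I -> 'cV[R]_#|I|, forall i j, dot (q' i) (q' j) = dot (q i) (q j).
Proof.
pose Q := \matrix_(r < d, x < #|I|) q (enum_val x) r 0.
have pG : psdmx (Q^T *m Q).
  apply: psdmxI => [|v]; first by rewrite trmx_mul trmxK.
  by rewrite -mulmxA -dot_mulmx_tr dot_ge0.
have [p GE] := psdmx_cholesky pG.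
exists (fun i => \col_a p a (enum_rank i) 0) => i j.
transitivity ((Q^T *m Q) (enum_rank i) (enum_rank j)).
  rewrite GE dotE summxE; apply: eq_bigr => a _.
  by rewrite !mxE big_ord1 !mxE.
by rewrite dotE mxE; apply: eq_bigr => r _; rewrite !mxE !enum_rankK.
Qed.

Definition sum_rank1 n k D (q : 'I_n -> 'I_k -> 'cV[R]_D) (i : 'I_n) : 'M[R]_D :=
  \sum_a q i a *m (q i a)^T.

(** Only inner products enter, so the vectors may be moved isometrically or projected. *)
Lemma gram_sum_rank1 n k D (q : 'I_n -> 'I_k -> 'cV[R]_D) i j :
  gram_mx (sum_rank1 q) i j = \sum_a \sum_b dot (q i a) (q j b) ^+ 2.
Proof.
rewrite mxE mulmx_suml linear_sum; apply: eq_bigr => a _ /=.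
rewrite tr_rank1_mul mulmx_suml /dot mulmx_sumr summxE; apply: eq_bigr => b _.
by rewrite rank1_mul -scalemxAr mxE expr2 [dot (q j b) _]dotC.
Qed.

Lemma gram_sum_rank1P n k D (q : 'I_n -> 'I_k -> 'cV[R]_D) :
  (0 < D)%N -> has_gram_rep (gram_mx (sum_rank1 q)) D.
Proof.
by move=> D0; split=> //; exists (sum_rank1 q); split=> // i; apply: psdmx_sum_rank1.
Qed.

Lemma cpsd_rank_le n (N : 'M[R]_n) (hN : cpsd N) D :
  has_gram_rep N D -> (cpsd_rank hN <= D)%N.
Proof.
by move=> ND; rewrite /cpsd_rank; case: ex_minnP => m _; apply; apply/asboolP.
Qed.

End GramFamilies.

(** * Averages over random sign vectors and their exponential moments *)

Section SignAverages.
Variable R : realType.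

(** From [expR (- z) >= (1 - z / 2) ^+ 2], it suffices that
    [(1 + z + z ^+ 2) * (1 - z / 2) ^+ 2 >= 1], which holds for [z <= 1 / 3]. *)
Lemma expR_le_quadratic (z : R) : `|z| <= 1 / 3 -> expR z <= 1 + z + z ^+ 2.
Proof.
rewrite ler_norml => /andP[z1 z2].
have h : 1 - z / 2 <= expR (- (z / 2)) by have := expR_ge1Dx (- (z / 2)).
have hp : 0 < 1 - z / 2 by lra.
have h2 : (1 - z / 2) ^+ 2 <= expR (- z).
  have -> : - z = 2%:R * (- (z / 2)) by field.
  by rewrite expRM_natl lerXn2r // nnegrE ?expR_ge0 // ltW.
have e0 := expR_gt0 (- z).
rewrite -[z in expR z]opprK expRN -[(expR _)^-1]mul1r ler_pdivrMr //.
have q0 : 0 <= 1 + z + z ^+ 2 by have := sqr_ge0 (z + 1 / 2); rewrite !expr2; lra.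
apply: le_trans (ler_wpM2l q0 h2).
rewrite -subr_ge0.
have -> : (1 + z + z ^+ 2) * (1 - z / 2) ^+ 2 - 1
    = z ^+ 2 / 4 * (1 - 3 * z + z ^+ 2) by field.
apply: mulr_ge0; last by have := sqr_ge0 z; lra.
by rewrite divr_ge0 ?sqr_ge0.
Qed.

(* The inequality passes from [z] to [2 * z], since
   [cosh (2 * z) = 2 * cosh z ^+ 2 - 1] and [2 * y - 1 <= y ^+ 2]. *)
Lemma expR_cosh_le (z : R) : (expR z + expR (- z)) / 2 <= expR (z ^+ 2).
Proof.
have small (y : R) : `|y| <= 1 / 3 -> (expR y + expR (- y)) / 2 <= expR (y ^+ 2).
  move=> y1; apply: le_trans (expR_ge1Dx _).
  have := expR_le_quadratic y1.
  have := @expR_le_quadratic (- y); rewrite normrN sqrrN => /(_ y1); lra.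
have scaled k (y : R) : `|y| <= 2 ^+ k / 3 ->
    (expR y + expR (- y)) / 2 <= expR (y ^+ 2).
  elim: k y => [|k IH] y hy; first by apply: small; rewrite expr0 in hy.
  have [x yE] : exists x, y = 2%:R * x by exists (y / 2); field.
  have hx : (expR x + expR (- x)) / 2 <= expR (x ^+ 2).
    by apply: IH; move: hy; rewrite yE normrM ger0_norm // exprS; lra.
  have -> : y ^+ 2 = 2%:R * (2%:R * x ^+ 2) by rewrite yE; ring.
  rewrite {}yE -mulrN !expRM_natl.
  have xx : expR x * expR (- x) = 1 by rewrite -expRD subrr expR0.
  have c0 : 0 <= (expR x + expR (- x)) / 2 by rewrite divr_ge0 ?addr_ge0 ?expR_ge0.
  have : ((expR x + expR (- x)) / 2) ^+ 2 <= expR (x ^+ 2) ^+ 2.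
    by rewrite lerXn2r // nnegrE expR_ge0.
  set u := expR x in xx *; set v := expR (- x) in xx *; set e := expR (x ^+ 2) ^+ 2.
  move=> h; apply: (@le_trans _ _ (2 * e - 1)).
    have -> : (u ^+ 2 + v ^+ 2) / 2 = 2 * ((u + v) / 2) ^+ 2 - u * v by field.
    by rewrite xx; lra.
  by have := sqr_ge0 (e - 1); rewrite !expr2; lra.
(* Finitely many doublings of [[-1/3, 1/3]] reach any [z]. *)
have [k hk] : exists k : nat, `|z| <= 2 ^+ k / 3.
  have [m hm] : exists m : nat, `|3 * z| < m%:R.
    by eexists; exact: archi_boundP.
  have m2 : m%:R <= 2 ^+ m :> R by rewrite -natrX ler_nat ltnW // ltn_expl.
  by exists m; move: hm; rewrite normrM ger0_norm //; lra.
exact: scaled hk.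
Qed.

(** Follows from [expR a >= 1 + a] and [(1 - a + a ^+ 2) * (1 + a) = 1 + a ^+ 3]. *)
Lemma expRN_le_quadratic (a : R) : 0 <= a -> expR (- a) <= 1 - a + a ^+ 2.
Proof.
move=> a0; have h := expR_ge1Dx a.
have q0 : 0 <= 1 - a + a ^+ 2 by have := sqr_ge0 (a - 1 / 2); rewrite !expr2; lra.
rewrite expRN -[(expR _)^-1]mul1r ler_pdivrMr ?expR_gt0 //.
apply: le_trans (ler_wpM2l q0 h).
have -> : (1 - a + a ^+ 2) * (1 + a) = 1 + a ^+ 3 by ring.
by rewrite lerDl exprn_ge0.
Qed.

(** Expectation over uniform signs in [{-1, 1}^d]. The recursion on coordinates replaces a
    probability space and supports induction on [d]. *)
Fixpoint sign_avg d : ('cV[R]_d -> R) -> R :=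
  if d is e.+1 then fun f =>
    (sign_avg (fun s : 'cV[R]_e => f (col_mx (1%:M : 'M[R]_1) s))
     + sign_avg (fun s : 'cV[R]_e => f (col_mx ((-1)%:M : 'M[R]_1) s))) / 2
  else fun f => f 0.

Lemma sign_avg_le d (f g : 'cV[R]_d -> R) :
  (forall s, f s <= g s) -> sign_avg f <= sign_avg g.
Proof.
elim: d f g => [|d IH] f g fg /=; first exact: fg.
by rewrite ler_pM2r ?invr_gt0 // lerD // IH.
Qed.

Lemma sign_avg_ex d (f : 'cV[R]_d -> R) : exists s, f s <= sign_avg f.
Proof.
elim: d f => [|d IH] f /=; first by exists 0.
have [s1 h1] := IH (fun s => f (col_mx (1%:M : 'M[R]_1) s)).
have [s2 h2] := IH (fun s => f (col_mx ((-1)%:M : 'M[R]_1) s)).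
move: h1 h2; set a := sign_avg _; set b := sign_avg _ => h1 h2.
have [ab|ba] := lerP a b; [exists (col_mx 1%:M s1)|exists (col_mx (-1)%:M s2)].
  apply: le_trans h1 _; lra.
apply: le_trans h2 _; lra.
Qed.

Lemma sign_avgD d (f g : 'cV[R]_d -> R) :
  sign_avg (fun s => f s + g s) = sign_avg f + sign_avg g.
Proof.
by elim: d f g => [|d IH] f g //=; rewrite !IH; field.
Qed.

Lemma sign_avgZ d c (f : 'cV[R]_d -> R) :
  sign_avg (fun s => c * f s) = c * sign_avg f.
Proof.
by elim: d f => [|d IH] f //=; rewrite !IH; field.
Qed.

Lemma sign_avg_cst d c : sign_avg (fun _ : 'cV[R]_d => c) = c.
Proof. by elim: d => [|d IH] //=; rewrite !IH; field. Qed.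

Lemma sign_avg_sum d (J : finType) (f : J -> 'cV[R]_d -> R) :
  sign_avg (fun s => \sum_j f j s) = \sum_j sign_avg (f j).
Proof.
elim: d f => [|d IH] f //=; rewrite !IH -big_split /= mulr_suml.
by apply: eq_bigr.
Qed.

Lemma dot_sign_col d (c : R) (s : 'cV[R]_d) (w : 'cV[R]_d.+1) :
  dot (col_mx (c%:M : 'M[R]_1) s) w
    = c * (w ord0 0) + dot s (dsubmx (w : 'cV_(1 + d))).
Proof.
rewrite -[in LHS](vsubmxK (w : 'cV_(1 + d))) dot_col_mx; congr (_ + _).
rewrite /dot !mxE big_ord1 !mxE eqxx mulr1n; congr (_ * w _ _).
exact/val_inj.
Qed.

Lemma dot_dsubmx d (w : 'cV[R]_d.+1) :
  dot w w = (w ord0 0) ^+ 2 + dot (dsubmx (w : 'cV_(1 + d))) (dsubmx (w : 'cV_(1 + d))).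
Proof.
pose w1 : 'cV_(1 + d) := w.
rewrite -[LHS]/(dot w1 w1) -[in LHS](vsubmxK w1) dot_col_mx; congr (_ + _).
by rewrite /dot !mxE big_ord1 !mxE expr2; congr (w _ _ * w _ _); apply/val_inj.
Qed.

(* The shift [x] makes the bound reproduce itself when one coordinate of [w] is
   averaged out. *)
Lemma sign_avg_expR_sqr d (t x : R) (w : 'cV[R]_d) :
  0 < t -> 4 * t * dot w w < 1 ->
  sign_avg (fun s => expR (t * (x + dot s w) ^+ 2))
    <= expR (t * (x ^+ 2 + dot w w) / (1 - 4 * t * dot w w)).
Proof.
move=> t0; elim: d x w => [|d IH] x w.
  move=> _; rewrite /= dot0l [dot w w](_ : _ = 0); last by rewrite dotE big_ord0.
  by rewrite !addr0 mulr0 subr0 divr1.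
rewrite dot_dsubmx /=; set w' := dsubmx _; set a := w ord0 0; set S := dot w' w'.
move=> tS; have S0 : 0 <= S by exact: dot_ge0.
have a0 := sqr_ge0 a.
have tS' : 4 * t * S < 1.
  by apply: le_lt_trans tS; rewrite ler_pM2l ?lerDr // mulr_gt0.
set D := 1 - 4 * t * S; have D0 : 0 < D by rewrite subr_gt0.
(* [r] is the effective parameter once all coordinates but the first are averaged out. *)
set r := t / D; have r0 : 0 < r by rewrite divr_gt0.
have step (c : R) : sign_avg (fun s : 'cV[R]_d =>
    expR (t * (x + dot (col_mx (c%:M : 'M[R]_1) s) w) ^+ 2))
    <= expR (r * ((x + c * a) ^+ 2 + S)).
  have := IH (x + c * a) w' tS'; rewrite -/S -/D [in leRHS]mulrAC -/r.
  apply: le_trans; apply: sign_avg_le => s.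
  by rewrite dot_sign_col addrA.
apply: (@le_trans _ _ ((expR (r * ((x + 1 * a) ^+ 2 + S)) +
                        expR (r * ((x + -1 * a) ^+ 2 + S))) / 2)).
  by rewrite ler_pM2r ?invr_gt0 // lerD // step.
have -> : r * ((x + 1 * a) ^+ 2 + S)
    = r * (x ^+ 2 + a ^+ 2 + S) + 2 * r * x * a by ring.
have -> : r * ((x + -1 * a) ^+ 2 + S)
    = r * (x ^+ 2 + a ^+ 2 + S) - 2 * r * x * a by ring.
(* The two signs differ only in the cross term, whose average is a [cosh] and costs at most
   [(2 * r * x * a) ^+ 2] in the exponent. *)
rewrite !expRD -mulrDr -mulrA.
apply: le_trans (ler_wpM2l (expR_ge0 _) (expR_cosh_le _)) _.
rewrite -expRD ler_expR.
set D' := 1 - 4 * t * (a ^+ 2 + S); have D'0 : 0 < D' by rewrite subr_gt0.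
rewrite ler_pdivlMr //.
have DE : D' = D * (1 - 4 * r * a ^+ 2).
  by rewrite /D' /r; have := gt_eqF D0; rewrite /D => DN; field; rewrite DN.
have tE : t = D * r by rewrite /r mulrC divfK // gt_eqF.
rewrite DE tE -subr_ge0.
have -> : D * r * (x ^+ 2 + (a ^+ 2 + S))
    - (r * (x ^+ 2 + a ^+ 2 + S) + (2 * r * x * a) ^+ 2) * (D * (1 - 4 * r * a ^+ 2))
    = D * r * (4 * r * a ^+ 2) * (a ^+ 2 + S + x ^+ 2 * (4 * r * a ^+ 2)) by ring.
have y0 : 0 <= 4 * r * a ^+ 2 := mulr_ge0 (mulr_ge0 (ler0n R 4) (ltW r0)) a0.
apply: (mulr_ge0 (mulr_ge0 (mulr_ge0 (ltW D0) (ltW r0)) y0)).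
by rewrite !addr_ge0 // mulr_ge0 // sqr_ge0.
Qed.

Lemma sign_avg_sqr d (x : R) (w : 'cV[R]_d) :
  sign_avg (fun s => (x + dot s w) ^+ 2) = x ^+ 2 + dot w w.
Proof.
elim: d x w => [|d IH] x w.
  by rewrite /= dot0l [dot w w](_ : _ = 0) ?addr0 // dotE big_ord0.
rewrite dot_dsubmx /=; set w' := dsubmx _; set a := w ord0 0.
have step (c : R) : sign_avg (fun s : 'cV[R]_d =>
    (x + dot (col_mx (c%:M : 'M[R]_1) s) w) ^+ 2) = (x + c * a) ^+ 2 + dot w' w'.
  by rewrite -IH; congr sign_avg; apply/funext => s; rewrite dot_sign_col addrA.
by rewrite !step; field.
Qed.

(** The bound is the fourth moment of [x] plus a centered Gaussian of variance [dot w w]; each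
    coordinate [a] loses [2 * a ^+ 4] against it. *)
Lemma sign_avg_pow4 d (x : R) (w : 'cV[R]_d) :
  sign_avg (fun s => (x + dot s w) ^+ 4)
    <= x ^+ 4 + 6 * x ^+ 2 * dot w w + 3 * dot w w ^+ 2.
Proof.
elim: d x w => [|d IH] x w.
  rewrite /= dot0l [dot w w](_ : _ = 0); last by rewrite dotE big_ord0.
  by rewrite expr0n /= !mulr0 !addr0.
rewrite dot_dsubmx /=; set w' := dsubmx _; set a := w ord0 0; set S := dot w' w'.
have step (c : R) : sign_avg (fun s : 'cV[R]_d =>
    (x + dot (col_mx (c%:M : 'M[R]_1) s) w) ^+ 4)
    <= (x + c * a) ^+ 4 + 6 * (x + c * a) ^+ 2 * S + 3 * S ^+ 2.
  by apply: le_trans (IH _ w'); apply: sign_avg_le => s; rewrite dot_sign_col addrA.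
apply: le_trans (ler_wpM2r _ (lerD (step 1) (step (-1)))) _.
  by rewrite invr_ge0.
rewrite -subr_ge0 [leRHS](_ : _ = 2 * (a ^+ 2) ^+ 2); last by field.
by rewrite mulr_ge0 // sqr_ge0.
Qed.

(** Covers both tails. Positive [t] uses the exponential moment of the square; negative [t] needs
    only the second and fourth moments. *)
Lemma sign_avg_expR_centered d (t : R) (w : 'cV[R]_d) :
  `|t| * dot w w <= 1 / 20 ->
  sign_avg (fun s => expR (t * (dot s w ^+ 2 - dot w w)))
    <= expR (5 * (t * dot w w) ^+ 2).
Proof.
set S := dot w w; have S0 : 0 <= S by exact: dot_ge0.
have [t0|t0|->] := ltrgt0P t; last first.
- move=> _; rewrite mul0r expr0n mulr0 /=.
  by under eq_fun do rewrite mul0r; rewrite sign_avg_cst.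
- rewrite mulNr => hS; pose u := - t; have u0 : 0 < u by rewrite oppr_gt0.
  have -> : t = - u by rewrite opprK.
  have uS : u * S <= 1 / 20 by rewrite mulNr.
  rewrite mulNr sqrrN.
  apply: (@le_trans _ _ (sign_avg (fun s =>
      expR (u * S) * (1 + (- u) * (0 + dot s w) ^+ 2
                        + u ^+ 2 * (0 + dot s w) ^+ 4)))).
    apply: sign_avg_le => s; rewrite add0r mulNr mulrBr opprB expRD.
    rewrite ler_wpM2l ?expR_ge0 //.
    have -> : 1 + - u * dot s w ^+ 2 + u ^+ 2 * dot s w ^+ 4
        = 1 - u * dot s w ^+ 2 + (u * dot s w ^+ 2) ^+ 2 by ring.
    by apply: expRN_le_quadratic; rewrite mulr_ge0 ?sqr_ge0 // ltW.
  rewrite sign_avgZ !sign_avgD !sign_avgZ sign_avg_cst sign_avg_sqr.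
  have := sign_avg_pow4 0 w; rewrite -/S !expr0n /= mulr0 mul0r !add0r => h4.
  have h : 1 + - u * S + u ^+ 2 * sign_avg (fun s => (0 + dot s w) ^+ 4)
      <= expR (- (u * S) + 3 * (u * S) ^+ 2).
    apply: le_trans (expR_ge1Dx _); rewrite -addrA lerD2l mulNr lerD2l.
    apply: le_trans (ler_wpM2l (sqr_ge0 u) h4) _.
    by rewrite exprMn mulrCA.
  apply: le_trans (ler_wpM2l (expR_ge0 _) h) _.
  rewrite -expRD ler_expR addrA subrr add0r.
  by rewrite ler_wpM2r ?sqr_ge0 // ler_nat.
move=> hS.
have hS' : 4 * t * S <= 1 / 5 by rewrite -mulrA; lra.
have tS0 : 0 <= t * S := mulr_ge0 (ltW t0) S0.
have := @sign_avg_expR_sqr _ t 0 w t0; rewrite -/S => /(_ _)/le_trans h.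
apply: (@le_trans _ _ (sign_avg (fun s =>
    expR (- (t * S)) * expR (t * (0 + dot s w) ^+ 2)))).
  by apply: sign_avg_le => s; rewrite add0r -expRD mulrBr addrC.
rewrite sign_avgZ.
have hs : sign_avg (fun s => expR (t * (0 + dot s w) ^+ 2))
    <= expR (t * S + 5 * (t * S) ^+ 2).
  apply: h; first lra.
  rewrite ler_expR expr0n add0r -[4 * t * S]mulrA; rewrite -mulrA in hS'.
  set y := t * S in tS0 hS' *; rewrite ler_pdivrMr; last lra.
  (* Here [y <= 1 / 20] yields [y / (1 - 4 * y) <= y + 5 * y ^+ 2]. *)
  have -> : (y + 5 * y ^+ 2) * (1 - 4 * y) = y + y ^+ 2 * (1 - 20 * y) by ring.
  by rewrite lerDl mulr_ge0 ?sqr_ge0 //; lra.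
apply: le_trans (ler_wpM2l (expR_ge0 _) hs) _.
by rewrite -expRD addrA addNr add0r.
Qed.

End SignAverages.

(** * Johnson-Lindenstrauss projection by sign matrices, for norms and inner products *)

Section JohnsonLindenstrauss.
Variable R : realType.

(* The rows are chosen one at a time: some sign vector does not exceed the
   average of the potential over all of them. *)
Lemma sign_matrix_potential (J : finType) d (w : J -> 'cV[R]_d) (tau : J -> R)
    (t : R) m :
  (forall j, `|tau j| * dot (w j) (w j) <= t) -> t <= 1 / 20 ->
  exists P : 'M[R]_(m, d),
    \sum_j expR (tau j * (dot (P *m w j) (P *m w j) - m%:R * dot (w j) (w j)))
      <= #|J|%:R * expR (5 * t ^+ 2) ^+ m.
Proof.
move=> tauw t1; elim: m => [|m [P hP]].
  exists 0; rewrite expr0 mulr1 -sumr_const ler_sum // => j _.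
  by rewrite mul0mx dot0l mul0r subrr mulr0 expR0.
pose c j := expR (tau j * (dot (P *m w j) (P *m w j) - m%:R * dot (w j) (w j))).
have [s hs] := sign_avg_ex (fun s : 'cV[R]_d =>
  \sum_j c j * expR (tau j * (dot s (w j) ^+ 2 - dot (w j) (w j)))).
pose P1 : 'M[R]_(m.+1, d) := col_mx s^T P.
have P1E j : dot (P1 *m w j) (P1 *m w j)
    = dot s (w j) ^+ 2 + dot (P *m w j) (P *m w j).
  pose r := col_mx (s^T *m w j) (P *m w j).
  rewrite [LHS](_ : _ = dot r r); last by rewrite /r -mul_col_mx.
  by rewrite dot_col_mx; congr (_ + _); rewrite dotE big_ord1 expr2.
exists P1; rewrite [leLHS](_ : _ = \sum_j c j *
    expR (tau j * (dot s (w j) ^+ 2 - dot (w j) (w j)))); last first.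
  apply: eq_bigr => j _; rewrite /c -expRD -mulrDr P1E -natr1.
  congr (expR (_ * _)); ring.
apply: le_trans hs _; rewrite sign_avg_sum exprSr mulrA.
apply: le_trans (ler_wpM2r (expR_ge0 _) hP).
rewrite mulr_suml; apply: ler_sum => j _; rewrite sign_avgZ.
rewrite ler_wpM2l ?expR_ge0 //.
apply: le_trans (sign_avg_expR_centered (le_trans (tauw j) t1)) _.
rewrite ler_expR ler_wpM2l // -[X in X <= _]ger0_norm ?sqr_ge0 // normrX.
rewrite lerXn2r ?nnegrE ?normr_ge0 //.
  by apply: le_trans (tauw j); rewrite mulr_ge0 ?dot_ge0.
by rewrite normrM (ger0_norm (dot_ge0 _)).
Qed.

(** The potential runs over [J * bool], so both tails are controlled at once; each single term is at
    most the whole sum. *)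
Lemma johnson_lindenstrauss_norm (J : finType) d (w : J -> 'cV[R]_d)
    (delta : R) m :
  0 < delta -> delta <= 1 / 2 -> (0 < m)%N ->
  #|J|%:R * 2 < expR (m%:R * delta ^+ 2 / 20) ->
  exists P : 'M[R]_(m, d), forall j,
    `|dot (P *m w j) (P *m w j) - dot (w j) (w j)| <= delta * dot (w j) (w j).
Proof.
move=> d0 d1 m0 hm; set t := delta / 10.
have m0' : 0 < m%:R :> R by rewrite ltr0n.
have t0 : 0 < t by rewrite divr_gt0.
(* Normalizing by [|w|^2] makes the error relative; for [w = 0] the weight is [0]. *)
pose tau (x : J * bool) : R := (-1) ^+ x.2 * (t / dot (w x.1) (w x.1)).
have [||P hP] := @sign_matrix_potential _ _ (fun x : J * bool => w x.1) tau t m.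
- move=> [j b]; rewrite /tau normrM normr_sign mul1r /=.
  have [->|j0] := eqVneq (dot (w j) (w j)) 0; first by rewrite mulr0 ltW.
  by rewrite normrM normfV (ger0_norm (dot_ge0 _)) divfK // ger0_norm // ltW.
- by rewrite /t; lra.
exists ((Num.sqrt m%:R)^-1 *: P) => j.
rewrite -scalemxAl dotZl dotZr mulrA -expr2 exprVn sqr_sqrtr ?ler0n //.
set Q := dot _ _; set S := dot _ _.
have [S0|SN0] := eqVneq S 0.
  by rewrite /Q (dot_eq0 S0) mulmx0 dot0l S0 !mulr0 subrr normr0.
have S0 : 0 < S by rewrite lt_neqAle eq_sym SN0 dot_ge0.
have key (b : bool) : (-1) ^+ b * (Q - m%:R * S) <= m%:R * delta * S.
  have : expR (tau (j, b) * (Q - m%:R * S)) < expR (m%:R * delta ^+ 2 / 10).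
    apply: (@le_lt_trans _ _
      (\sum_(x : J * bool) expR (tau x * (dot (P *m w x.1) (P *m w x.1)
         - m%:R * dot (w x.1) (w x.1))))).
      rewrite (bigD1 (j, b)) //= lerDl sumr_ge0 // => x _; exact: expR_ge0.
    apply: (le_lt_trans hP); rewrite card_prod card_bool natrM -expRM_natl.
    (* With [t = delta / 10], half of the exponent pays for the potential and half for the factor
       [2 * #|J|]. *)
    have -> : m%:R * delta ^+ 2 / 10 = m%:R * delta ^+ 2 / 20 + m%:R * (5 * t ^+ 2).
      by rewrite /t; field.
    by rewrite expRD ltr_pM2r ?expR_gt0.
  rewrite ltr_expR /tau /= -/S -(ltr_pM2r S0) => h.
  rewrite ltW // -(ltr_pM2r t0).
  move: h; congr (_ < _); last by rewrite /t; field.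
  by field; rewrite gt_eqF.
have := key true; have := key false; rewrite expr0 expr1 mul1r mulN1r => k1 k2.
have -> : m%:R^-1 * Q - S = (Q - m%:R * S) / m%:R.
  by field; rewrite gt_eqF.
rewrite normrM normfV (ger0_norm (ltW m0')) ler_pdivrMr // ler_norml.
by apply/andP; split; lra.
Qed.

Definition nrm d (u : 'cV[R]_d) : R := Num.sqrt (dot u u).

Lemma nrm_sqr d (u : 'cV[R]_d) : nrm u ^+ 2 = dot u u.
Proof. by rewrite sqr_sqrtr ?dot_ge0. Qed.

Lemma nrm_ge0 d (u : 'cV[R]_d) : 0 <= nrm u.
Proof. exact: sqrtr_ge0. Qed.

Lemma dot_le_nrm d (u v : 'cV[R]_d) : `|dot u v| <= nrm u * nrm v.
Proof.
rewrite -(@ler_pXn2r _ 2) ?nnegrE ?mulr_ge0 ?nrm_ge0 //.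
by rewrite exprMn !nrm_sqr real_normK ?num_real // dot_CS.
Qed.

(* Polarization with [|v| u + |u| v] and [|v| u - |u| v], which makes the error
   homogeneous in [u] and [v]. *)
Lemma johnson_lindenstrauss_dot (I : finType) d (q : I -> 'cV[R]_d)
    (delta : R) m :
  0 < delta -> delta <= 1 / 2 -> (0 < m)%N ->
  4 * #|I|%:R ^+ 2 < expR (m%:R * delta ^+ 2 / 20) ->
  exists P : 'M[R]_(m, d), forall i j,
    `|dot (P *m q i) (P *m q j) - dot (q i) (q j)|
      <= delta * (nrm (q i) * nrm (q j)).
Proof.
move=> d0 d1 m0 hm.
pose w (x : I * I * bool) :=
  nrm (q x.1.2) *: q x.1.1 + ((-1) ^+ x.2 * nrm (q x.1.1)) *: q x.1.2.
have [|P hP] := @johnson_lindenstrauss_norm _ _ w _ _ d0 d1 m0.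
  (* There are [2 * #|I| ^ 2] vectors [w], and the norm lemma doubles this count. *)
  apply: le_lt_trans hm; rewrite !card_prod card_bool !natrM expr2; lra.
exists P => i j.
have := hP (i, j, true); have := hP (i, j, false); rewrite /w /=.
rewrite expr0 expr1 mul1r mulN1r !mulmxDr -!scalemxAr.
rewrite !(dotDl, dotDr, dotZl, dotZr).
rewrite [dot (q j) (q i)]dotC [dot (P *m q j) (P *m q i)]dotC.
rewrite -(nrm_sqr (q i)) -(nrm_sqr (q j)).
have a0 := nrm_ge0 (q i); have b0 := nrm_ge0 (q j).
have := dot_le_nrm (q i) (q j).
set a := nrm (q i) in a0 *; set b := nrm (q j) in b0 *.
have [ab0|abN0] := eqVneq (a * b) 0.
  move=> _ _ _; have [qi|qj] : q i = 0 \/ q j = 0.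
  - move/eqP: ab0; rewrite mulf_eq0 => /orP[]/eqP e; [left|right];
      by apply: dot_eq0; rewrite -nrm_sqr -?/a -?/b e expr0n.
  - by rewrite qi mulmx0 !dot0l subrr normr0 ab0 mulr0.
  by rewrite qj mulmx0 !(dotC _ 0) !dot0l subrr normr0 ab0 mulr0.
have ab : 0 < a * b by rewrite lt_neqAle eq_sym abN0 mulr_ge0.
move=> _; set x := dot (P *m q i) (P *m q j); set y := dot (q i) (q j).
rewrite !ler_norml => /andP[p1 p2] /andP[p3 p4].
(* Subtracting the two norm errors leaves [4 * a * b * (x - y)], while the two squared norms sum to
   [4 * a ^+ 2 * b ^+ 2]. *)
have e1 : 4 * (a * b) * (x - y) <= 4 * (a * b) * (delta * (a * b)).
  rewrite !expr2 in p1 p2 p3 p4; lra.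
have e2 : 4 * (a * b) * - (delta * (a * b)) <= 4 * (a * b) * (x - y).
  rewrite !expr2 in p1 p2 p3 p4; lra.
have ab4 : 0 < 4 * (a * b) by rewrite mulr_gt0.
by rewrite -(ler_pM2l ab4) e2 -(ler_pM2l ab4) e1.
Qed.

End JohnsonLindenstrauss.

(** * Error estimates, choice of dimensions and the two approximations *)

Section Approximation.
Variable R : realType.

Lemma tr_mul_lt d (A B : 'M[R]_d) (L b c : R) :
  A^T = A -> B^T = B -> \tr (A *m A) <= L -> \tr (B *m B) <= b ->
  L * b < c ^+ 2 -> 0 < c -> `|\tr (A *m B)| < c.
Proof.
move=> sA sB hA hB hc c0.
rewrite -(@ltr_pXn2r _ 2) ?nnegrE ?(ltW c0) // real_normK ?num_real //.
apply: le_lt_trans (tr_CS sA sB) (le_lt_trans _ hc).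
by apply: ler_pM; rewrite ?tr_sqr_ge0.
Qed.

(** With [A i = P i + B i], the error is [\tr (A i *m B j) + \tr (P j *m B i)]: two terms, each
    below [c] by Cauchy-Schwarz for the trace. *)
Lemma gram_truncate n d (A : 'I_n -> 'M[R]_d) (ell L : R) k :
  (forall i, psdmx (A i)) -> (forall i, \tr (A i) <= ell) ->
  (forall i, gram_mx A i i <= L) -> 0 < ell -> (0 < k)%N ->
  exists q : 'I_n -> 'I_k -> 'cV[R]_d,
    (forall i, \sum_a dot (q i a) (q i a) <= ell) /\
    forall c i j, L * ell ^+ 2 / k%:R < c ^+ 2 -> 0 < c ->
      `|gram_mx A i j - gram_mx (sum_rank1 q) i j| < 2 * c.
Proof.
move=> pA trA trAA l0 k0.
have [q qP] := choice (fun i => psdmx_truncate k0 l0 (pA i) (trA i)).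
exists q; split=> [i|c i j hc c0]; first by have [B []] := qP i.
rewrite [in X in X - _]mxE mxE.
have [Bi [pBi AiE _ trBi _]] := qP i; have [Bj [pBj AjE _ trBj trqj]] := qP j.
have trL i0 : \tr (A i0 *m A i0) <= L by have := trAA i0; rewrite mxE.
rewrite -/(sum_rank1 q i) in AiE; rewrite -/(sum_rank1 q j) in AjE trqj.
have pq i0 : psdmx (sum_rank1 q i0) by exact: psdmx_sum_rank1.
have -> : \tr (A i *m A j) - \tr (sum_rank1 q i *m sum_rank1 q j)
    = \tr (A i *m Bj) + \tr (sum_rank1 q j *m Bi).
  rewrite [\tr (sum_rank1 q j *m Bi)]mxtrace_mulC AiE AjE.
  rewrite !(mulmxDl, mulmxDr) !mxtraceD; ring.
apply: le_lt_trans (ler_normD _ _) _.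
have h1 : `|\tr (A i *m Bj)| < c.
  by apply: tr_mul_lt (trL i) trBj _ c0; rewrite ?psdmx_tr // mulrA.
have h2 : `|\tr (sum_rank1 q j *m Bi)| < c.
  apply: tr_mul_lt (le_trans trqj (trL j)) trBi _ c0; rewrite ?psdmx_tr //.
  by rewrite mulrA.
lra.
Qed.

(** An inner product [y] moved to [x], with [g] the product of norms, gives [|x^2 - y^2| <= delta *
    g * (delta * g + 2 * g)]; the [g ^+ 2] sum to a product of two sums bounded by [ell]. *)
Lemma gram_project n k d m (q : 'I_n -> 'I_k -> 'cV[R]_d) (P : 'M[R]_(m, d))
    (ell delta : R) :
  0 <= delta -> (forall i, \sum_a dot (q i a) (q i a) <= ell) ->
  (forall i j a b, `|dot (P *m q i a) (P *m q j b) - dot (q i a) (q j b)|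
      <= delta * (nrm (q i a) * nrm (q j b))) ->
  forall i j,
    `|gram_mx (sum_rank1 q) i j
      - gram_mx (sum_rank1 (fun i a => P *m q i a)) i j|
    <= (2 * delta + delta ^+ 2) * ell ^+ 2.
Proof.
move=> d0 ql hP i j; rewrite !gram_sum_rank1 -sumrB.
have s0 i0 : 0 <= \sum_a dot (q i0 a) (q i0 a).
  by apply: sumr_ge0 => a _; apply: dot_ge0.
have D0 : 0 <= 2 * delta + delta ^+ 2 by rewrite addr_ge0 ?mulr_ge0 ?sqr_ge0.
apply: (@le_trans _ _ ((2 * delta + delta ^+ 2) *
    ((\sum_a dot (q i a) (q i a)) * \sum_b dot (q j b) (q j b)))).
  rewrite mulr_suml mulr_sumr; apply: le_trans (ler_norm_sum _ _ _) (ler_sum _ _).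
  move=> a _; rewrite -sumrB. rewrite mulr_sumr mulr_sumr.
  apply: le_trans (ler_norm_sum _ _ _) (ler_sum _ _) => b _.
  rewrite -!nrm_sqr -exprMn; have := hP i j a b.
  have := dot_le_nrm (q i a) (q j b).
  set g := nrm _ * nrm _; set x := dot (P *m _) _; set y := dot _ _ => yg xg.
  have g0 : 0 <= g by apply: le_trans yg.
  rewrite subr_sqr normrM distrC.
  have -> : (2 * delta + delta ^+ 2) * g ^+ 2 = (delta * g) * (delta * g + 2 * g).
    by ring.
  apply: ler_pM => //.
  have -> : y + x = (x - y) + y *+ 2 by ring.
  apply: le_trans (ler_normD _ _) (lerD xg _).
  by rewrite normrMn mulr_natl lerMn2r yg.
by rewrite ler_wpM2l // expr2 ler_pM.
Qed.

Lemma ceil_nat (x : R) : 0 < x ->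
  exists k : nat, [/\ (0 < k)%N, x <= k%:R & (Num.ceil x)%:~R = k%:R :> R].
Proof.
move=> x0; have := ceil_gt0 x; rewrite x0; have := ceil_ge x.
by case: (Num.ceil x) => // k; exists k.
Qed.

Lemma cpsd_approx_truncate n d (A : 'I_n -> 'M[R]_d) (ell L eps : R) :
  (0 < n)%N -> (forall i, psdmx (A i)) -> (forall i, \tr (A i) <= ell) ->
  (forall i, gram_mx A i i <= L) -> 0 < ell -> 0 < L -> 0 < eps ->
  exists (N : 'M[R]_n) (D : nat),
    [/\ has_gram_rep N D, forall i j, `|gram_mx A i j - N i j| < eps
      & D%:R <= n%:R * (Num.ceil (9 * L * ell ^+ 2 / (2 * eps ^+ 2)))%:~R :> R].
Proof.
move=> n0 pA trA trAA ell0 L0 e0.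
have e2 : 0 < eps ^+ 2 by rewrite exprn_gt0.
have Ll0 : 0 < L * ell ^+ 2 by rewrite mulr_gt0 ?exprn_gt0.
have [|k [k0 hk ->]] := ceil_nat (x := 9 * L * ell ^+ 2 / (2 * eps ^+ 2)).
  by rewrite divr_gt0 ?mulr_gt0 ?exprn_gt0.
have [q [_ qA]] := gram_truncate pA trA trAA ell0 k0.
have [q' q'E] := same_gram (fun x : 'I_n * 'I_k => q x.1 x.2).
pose q1 i a := q' (i, a).
have cardI : #|{: 'I_n * 'I_k}| = (n * k)%N by rewrite card_prod !card_ord.
exists (gram_mx (sum_rank1 q1)), #|{: 'I_n * 'I_k}|; split.
- by apply: gram_sum_rank1P; rewrite cardI muln_gt0 n0.
- move=> i j; have := qA (eps / 2) i j; have -> : 2 * (eps / 2) = eps by field.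
  rewrite !gram_sum_rank1; under [in X in _ -> X]eq_bigr do
    under eq_bigr do rewrite q'E.
  apply; last by rewrite divr_gt0.
  (* The choice of [k] gives [L * ell ^+ 2 / k <= 2 / 9 * eps ^+ 2], strictly below
     [(eps / 2) ^+ 2]. *)
  rewrite ler_pdivrMr ?mulr_gt0 // in hk; rewrite ltr_pdivrMr ?ltr0n //.
  rewrite exprMn exprVn; have : 0 < eps ^+ 2 * k%:R by rewrite mulr_gt0 ?ltr0n.
  by move: hk; clear; lra.
- by rewrite cardI natrM.
Qed.

(** [m] is the integer part of the bound itself: the constant [6 ^ 4] yields [65.61 * ln (K + 1)]
    where [60 * ln (K + 1)] suffices, and the surplus absorbs the rounding. *)
Lemma jl_dimension (K ell eps : R) :
  1 <= K -> 0 < ell -> 0 < eps -> eps < 1 / 2 * ell ^+ 2 ->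
  exists m : nat,
    [/\ (0 < m)%N, m%:R <= (6 * ell) ^+ 4 * ln (K + 1) / eps ^+ 2
      & 4 * K ^+ 2 < expR (m%:R * (9 / 40 * (eps / ell ^+ 2)) ^+ 2 / 20)].
Proof.
move=> K1 ell0 e0 e_ell; have l2 : 0 < ell ^+ 2 by rewrite exprn_gt0.
set B := _ / eps ^+ 2; set delta := 9 / 40 * _.
have [delta0 delta1] : 0 < delta /\ delta <= 1 / 2.
  have : 0 < eps / ell ^+ 2 by rewrite divr_gt0.
  have : eps / ell ^+ 2 < 1 / 2 by rewrite ltr_pdivrMr.
  by rewrite /delta; lra.
have Bdelta : B * delta ^+ 2 = 6561 / 100 * ln (K + 1).
  by rewrite /B /delta; field; rewrite !gt_eqF.
(* That is, [4 * K ^+ 2 < (K + 1) ^+ 3]. *)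
have expK : 4 * K ^+ 2 < expR (3%:R * ln (K + 1)).
  rewrite expRM_natl lnK ?posrE; last by clear -K1; lra.
  rewrite -subr_gt0 (_ : _ - _ = (K - 1) ^+ 2 * (K + 1) + 4 * K); last by ring.
  have K0 : 0 <= K + 1 by clear -K1; lra.
  by rewrite ltr_wpDl ?(mulr_ge0 (sqr_ge0 _) K0) //; clear -K1; lra.
have lnK3 : 1 / 3 <= ln (K + 1).
  have h : expR (1 / 3) <= K + 1.
    have := @expR_le_quadratic R (1 / 3); rewrite ger0_norm ?divr_ge0 // lexx.
    by rewrite expr2 => /(_ isT); clear -K1; lra.
  by rewrite -[1 / 3]expRK ler_ln ?posrE ?expR_gt0 ?(lt_le_trans (expR_gt0 _) h).
have B0 : 0 <= B.
  rewrite divr_ge0 ?sqr_ge0 // mulr_ge0 //; last by clear -lnK3; lra.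
  by rewrite exprn_ge0 // mulr_ge0 // ltW.
have [mB Bm] : (Num.trunc B)%:R <= B /\ B < (Num.trunc B)%:R + 1.
  by have /andP[] := truncn_itv B0; rewrite natr1.
set m := Num.trunc B in mB Bm *.
have mdelta : 60 * ln (K + 1) < m%:R * delta ^+ 2.
  have : B * delta ^+ 2 < (m%:R + 1) * delta ^+ 2 by rewrite ltr_pM2r ?exprn_gt0.
  have : delta ^+ 2 <= (1 / 2) ^+ 2 by rewrite lerXn2r ?nnegrE // ltW.
  by rewrite Bdelta [(1 / 2) ^+ 2]expr2 mulrDl mul1r; clear -lnK3; lra.
exists m; split=> //.
  rewrite lt0n; apply/eqP => m0; move: mdelta; rewrite m0 mul0r.
  by clear -lnK3; lra.
by apply: (lt_trans expK); rewrite ltr_expR; clear -mdelta; lra.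
Qed.

Lemma cpsd_approx_project n d (A : 'I_n -> 'M[R]_d) (ell L eps : R) :
  (0 < n)%N -> (forall i, psdmx (A i)) -> (forall i, \tr (A i) <= ell) ->
  (forall i, gram_mx A i i <= L) -> 0 < ell -> 0 < L -> 0 < eps ->
  eps < 1 / 2 * ell ^+ 2 ->
  exists (N : 'M[R]_n) (D : nat),
    [/\ has_gram_rep N D, forall i j, `|gram_mx A i j - N i j| < eps
      & D%:R <= (6 * ell) ^+ 4
          * ln (n%:R * (Num.ceil (18 * L * ell ^+ 2 / eps ^+ 2))%:~R + 1)
          / eps ^+ 2].
Proof.
move=> n0 pA trA trAA ell0 L0 e0 e_ell.
have e2 : 0 < eps ^+ 2 by rewrite exprn_gt0.
have l2 : 0 < ell ^+ 2 by rewrite exprn_gt0.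
have Ll0 : 0 < L * ell ^+ 2 by rewrite mulr_gt0.
have [|k [k0 hk ->]] := ceil_nat (x := 18 * L * ell ^+ 2 / eps ^+ 2).
  by rewrite divr_gt0 // !mulr_gt0.
have [q [ql qA]] := gram_truncate pA trA trAA ell0 k0.
set K : R := n%:R * k%:R; have K1 : 1 <= K by rewrite /K -natrM ler1n muln_gt0 n0.
have [m [m0 mB expK]] := jl_dimension K1 ell0 e0 e_ell.
pose eta := eps / ell ^+ 2; set delta := 9 / 40 * _ in expK.
have eta0 : 0 < eta by rewrite divr_gt0.
have eta1 : eta < 1 / 2 by rewrite ltr_pdivrMr.
have delta0 : 0 < delta by rewrite mulr_gt0 // divr_gt0.
have delta1 : delta <= 1 / 2 by rewrite /delta -/eta; clear -eta0 eta1; lra.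
have [|P hP] := johnson_lindenstrauss_dot
    (fun x : 'I_n * 'I_k => q x.1 x.2) delta0 delta1 m0.
  by rewrite card_prod !card_ord natrM.
exists (gram_mx (sum_rank1 (fun i a => P *m q i a))), m; split=> //.
  exact: gram_sum_rank1P.
move=> i j.
(* Half of [eps] goes to truncation: [L * ell ^+ 2 / k <= eps ^+ 2 / 18 < (eps / 4) ^+ 2]. *)
have h1 : `|gram_mx A i j - gram_mx (sum_rank1 q) i j| < 2 * (eps / 4).
  apply: qA; last by rewrite divr_gt0.
  rewrite ler_pdivrMr // in hk; rewrite ltr_pdivrMr ?ltr0n //.
  rewrite exprMn exprVn; have : 0 < eps ^+ 2 * k%:R by rewrite mulr_gt0 ?ltr0n.
  by move: hk; clear; lra.
have h2 := gram_project (ltW delta0) ql (fun i j a b => hP (i, a) (j, b)) i j.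
(* The other half goes to projection: [delta = 9 / 40 * eta] and [eta < 1 / 2] give
   [2 * delta + delta ^+ 2 <= eta / 2]. *)
have h3 : (2 * delta + delta ^+ 2) * ell ^+ 2 <= eps / 2.
  have -> : eps / 2 = eta / 2 * ell ^+ 2 by rewrite /eta; field; rewrite gt_eqF.
  rewrite ler_pM2r // /delta -/eta.
  have : eta * eta <= eta * (1 / 2) by rewrite ler_pM2l // ltW.
  by rewrite expr2; clear -eta0; lra.
rewrite -[_ - _](subrKA (gram_mx (sum_rank1 q) i j)).
by apply: le_lt_trans (ler_normD _ _) _; clear -h1 h2 h3; lra.
Qed.

End Approximation.

Theorem theorem11 (R : realType) (n d : nat) (hn : (0 < n)%N) (hd : (0 < d)%N)
    (A : 'I_n -> 'M[R]_d) (hA : forall i, psdmx (A i)) :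
  let M := gram_mx A in
  let ell := max_ord hn (fun i => \tr (A i)) in
  let L := max_ord hn (fun i => M i i) in
  forall eps : R, 0 < eps -> eps < 1 / 2 * Num.min (ell ^+ 2) L ->
  exists (N : 'M[R]_n) (hN : cpsd N),
    (cpsd_rank hN)%:R <=
      Num.min
        (n%:R * (Num.ceil (9 * L * ell ^+ 2 / (2 * eps ^+ 2)))%:~R)
        ((6 * ell) ^+ 4
          * ln (n%:R * (Num.ceil (18 * L * ell ^+ 2 / eps ^+ 2))%:~R + 1)
          / eps ^+ 2)
    /\ forall i j, `|M i j - N i j| < eps.
Proof.
move=> M ell L eps e0 eM.
have trA i : \tr (A i) <= ell by exact: (le_bigmax _ (fun i => \tr (A i))).
have trAA i : gram_mx A i i <= L by exact: (le_bigmax _ (fun i => M i i)).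
have [e_ell e_L] : eps < 1 / 2 * ell ^+ 2 /\ eps < 1 / 2 * L.
  by split; apply: (lt_le_trans eM); rewrite ler_pM2l ?divr_gt0 // ge_min lexx ?orbT.
have L0 : 0 < L by lra.
have ell0 : 0 < ell.
  have := le_trans (psdmx_tr_ge0 (hA (Ordinal hn))) (trA _).
  rewrite le_eqVlt => /orP[/eqP ell0|//].
  by move: e_ell; rewrite -ell0 expr0n mulr0; lra.
have [N1 [D1 [g1 h1 b1]]] := cpsd_approx_truncate hn hA trA trAA ell0 L0 e0.
have [N2 [D2 [g2 h2 b2]]] := cpsd_approx_project hn hA trA trAA ell0 L0 e0 e_ell.
(* The approximation of smaller dimension meets both bounds, hence their minimum. *)
have [le12|le21] := leP D1 D2.
  exists N1, (ex_intro _ D1 g1); split=> //.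
  apply: (@le_trans _ _ D1%:R); first by rewrite ler_nat cpsd_rank_le.
  by rewrite le_min b1 (le_trans _ b2) // ler_nat.
exists N2, (ex_intro _ D2 g2); split=> //.
apply: (@le_trans _ _ D2%:R); first by rewrite ler_nat cpsd_rank_le.
by rewrite le_min b2 (le_trans _ b1) // ler_nat ltnW.
Qed.
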